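(* Let $n>1$ be an integer and let $R$ be an (associative unital) ring. Every left $R$-module has an epimorphic $\mathrm{FP}_n\text{-}\mathrm{Flat}$-envelope if and only if $R$ is right $n$-hereditary, where $\mathrm{FP}_n\text{-}\mathrm{Flat}$ denotes the class of $\mathrm{FP}_n$-flat left $R$-modules.
   Context: For an integer $n\ge 0$, a (left or right) module $M$ is finitely $n$-presented if there is an exact sequence $F_n\to\cdots\to F_1\to F_0\to M\to 0$ with every $F_i$ finitely generated projective; $\mathrm{FP}_n$ is the class of such modules. A left $R$-module $M$ is $\mathrm{FP}_n$-flat if $\mathrm{Tor}_1^R(F,M)=0$ for all right $R$-modules $F\in\mathrm{FP}_n$. A ring $R$ is right $n$-hereditary if every finitely $(n-1)$-presented submodule of a finitely generated projective right $R$-module is projective. For a class $\mathcal X$ of modules, an $\mathcal X$-preenvelope of $M$ is a map $\varphi\colon M\to X$ with $X\in\mathcal X$ such that every map $M\to X'$ with $X'\in\mathcal X$ factors through $\varphi$; it is an $\mathcal X$-envelope if moreover every endomorphism $f$ of $X$ with $f\varphi=\varphi$ is an automorphism. It is epimorphic if $\varphi$ is surjective. *)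

(* Defs.v *)
From HB Require Import structures.
From mathcomp Require Import all_boot all_algebra.
From mathcomp Require Import boolp.
From mathcomp.multinomials Require Import freeg.

Set Implicit Arguments.
Unset Strict Implicit.
Unset Printing Implicit Defensive.

Import GRing.Theory.
Local Open Scope ring_scope.
Local Open Scope quotient_scope.

(* A left R-module is an [lmodType R].  A right R-module is an [lmodType R^c],
   over the converse ring: x . a is written [a *: x].  [R : pzRingType] allows
   the zero ring. *)
Notation rmodType R := (lmodType (R : pzRingType)^c).

Definition surjective (A B : Type) (f : A -> B) : Prop :=
  forall y, exists x, f x = y.

Definition exact_at (A B C : zmodType) (f : A -> B) (g : B -> C) : Prop :=
  forall y, g y = 0 <-> exists x, f x = y.

Section Tensor.
Variables (R : pzRingType) (F : rmodType R) (M : lmodType R).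

Inductive tensor_relator : {freeg (F * M)} -> Prop :=
| TensorRel0 : tensor_relator 0
| TensorRelB u v :
    tensor_relator u -> tensor_relator v -> tensor_relator (u - v)
| TensorRelDl x y m :
    tensor_relator (<< (x + y, m) >> - << (x, m) >> - << (y, m) >>)
| TensorRelDr x m k :
    tensor_relator (<< (x, m + k) >> - << (x, m) >> - << (x, k) >>)
| TensorRelZ (a : R) x m :
    tensor_relator (<< ((a : R^c) *: x, m) >> - << (x, a *: m) >>).

Definition tensor_relatorb : {pred {freeg (F * M)}} :=
  fun u => `[< tensor_relator u >].

Fact tensor_relatorb_zmod_closed : zmod_closed tensor_relatorb.
Proof.
split=> [|u v /asboolP uR /asboolP vR]; apply/asboolP.
  exact: TensorRel0.
exact: TensorRelB.
Qed.

HB.instance Definition _ :=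
  GRing.isZmodClosed.Build _ tensor_relatorb tensor_relatorb_zmod_closed.

Definition tensor : zmodType := Quotient.quot tensor_relatorb.

Definition tensor_pi (u : {freeg (F * M)}) : tensor :=
  \pi_(Quotient.quot tensor_relatorb) u.

Definition tens (x : F) (m : M) : tensor := tensor_pi << (x, m) >>.

Lemma tensor_piD : {morph tensor_pi : u v / u + v}.
Proof. exact: raddfD. Qed.

Lemma tensor_piB : {morph tensor_pi : u v / u - v}.
Proof. exact: raddfB. Qed.

Lemma tensor_pi_eq u v : tensor_pi u = tensor_pi v <-> tensor_relator (u - v).
Proof.
split=> [/eqP|uv].
  by rewrite -Quotient.idealrBE => /asboolP.
by apply/eqP; rewrite -Quotient.idealrBE; apply/asboolP.
Qed.

Lemma tensor_pi_surj : surjective tensor_pi.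
Proof. by move=> t; exists (repr t); rewrite /tensor_pi reprK. Qed.

Lemma tensDl x y m : tens (x + y) m = tens x m + tens y m.
Proof.
rewrite -tensor_piD; apply/tensor_pi_eq; rewrite opprD addrA.
exact: TensorRelDl.
Qed.

Lemma tensDr x m k : tens x (m + k) = tens x m + tens x k.
Proof.
rewrite -tensor_piD; apply/tensor_pi_eq; rewrite opprD addrA.
exact: TensorRelDr.
Qed.

Lemma tensZ (a : R) x m : tens ((a : R^c) *: x) m = tens x (a *: m).
Proof. by apply/tensor_pi_eq; apply: TensorRelZ. Qed.

End Tensor.

Section TensorLift.
Variables (R : pzRingType) (F : rmodType R) (M : lmodType R) (A : zmodType).
Variable g : F -> M -> A.

Definition balanced : Prop :=
  [/\ forall m, {morph g^~ m : x y / x + y},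
      forall x, {morph g x : m k / m + k} &
      forall (a : R) x m, g ((a : R^c) *: x) m = g x (a *: m)].

(* Independent of the representative only when [g] is balanced; see
   [tensor_lift_tens] and [tensor_liftD]. *)
Definition tensor_lift (t : tensor F M) : A :=
  fglift (fun p => g p.1 p.2 : zmodule A) (repr t).

Hypothesis gB : balanced.

Let lift (u : {freeg (F * M)}) : zmodule A := fglift (fun p => g p.1 p.2 : zmodule A) u.

Let liftB : {morph lift : u v / u - v}.
Proof. exact: lift_is_additive. Qed.

Let liftU p : lift << p >> = g p.1 p.2.
Proof. by rewrite /lift liftU scale1r. Qed.

Let lift_relator u : tensor_relator u -> lift u = 0.
Proof.
have [gDl gDr gZ] := gB.
elim=> {u}.
- by rewrite -(subrr 0) liftB subrr.
- by move=> u v _ u0 _ v0; rewrite liftB u0 v0 subr0.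
- by move=> x y m; rewrite !liftB !liftU /= gDl addrAC addrK subrr.
- by move=> x m k; rewrite !liftB !liftU /= gDr addrAC addrK subrr.
- by move=> a x m; rewrite liftB !liftU /= gZ subrr.
Qed.

Let tensor_lift_pi u : tensor_lift (tensor_pi u) = lift u.
Proof.
apply/eqP; rewrite -subr_eq0; apply/eqP.
rewrite -[LHS](liftB _ u); apply/lift_relator/tensor_pi_eq.
by rewrite /tensor_pi reprK.
Qed.

Lemma tensor_lift_tens x m : tensor_lift (tens x m) = g x m.
Proof. by rewrite tensor_lift_pi liftU. Qed.

Lemma tensor_liftB : {morph tensor_lift : t s / t - s}.
Proof.
move=> t s; have [u <-] := tensor_pi_surj t; have [v <-] := tensor_pi_surj s.
by rewrite -tensor_piB !tensor_lift_pi liftB.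
Qed.

End TensorLift.

Section TensorMap.
Variables (R : pzRingType) (F G : rmodType R) (M : lmodType R).
Variable f : {linear F -> G}.

Fact tens_comp_balanced : balanced (fun (x : F) (m : M) => tens (f x) m).
Proof.
split=> [m x y|x m k|a x m] /=.
- by rewrite linearD tensDl.
- exact: tensDr.
- by rewrite linearZ tensZ.
Qed.

Definition tensor_map : tensor F M -> tensor G M :=
  tensor_lift (fun x m => tens (f x) m).

Lemma tensor_map_tens x m : tensor_map (tens x m) = tens (f x) m.
Proof. exact/tensor_lift_tens/tens_comp_balanced. Qed.

Fact tensor_map_is_zmod_morphism : zmod_morphism tensor_map.
Proof. exact/tensor_liftB/tens_comp_balanced. Qed.

HB.instance Definition _ :=
  GRing.isZmodMorphism.Build (tensor F M) (tensor G M) tensor_map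
    tensor_map_is_zmod_morphism.

End TensorMap.

Section Modules.
Variable S : pzRingType.

Definition projective (P : lmodType S) : Prop :=
  forall (A B : lmodType S) (g : {linear A -> B}) (h : {linear P -> B}),
    surjective g -> exists k : {linear P -> A}, forall x, g (k x) = h x.

Definition fin_generated (M : lmodType S) : Prop :=
  exists (n : nat) (e : 'I_n -> M),
    forall x, exists c : 'I_n -> S, x = \sum_(i < n) c i *: e i.

(* F_n -> ... -> F_1 -> F_0 -> M -> 0, with [d i : F_(i+1) -> F_i]; the values
   of [F] beyond n and of [d] from n on are irrelevant. *)
Definition fin_presented (n : nat) (M : lmodType S) : Prop :=
  exists (F : nat -> lmodType S) (d : forall i, {linear F i.+1 -> F i})
         (eps : {linear F 0%N -> M}),
    [/\ forall i, (i <= n)%N -> fin_generated (F i) /\ projective (F i),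
        surjective eps,
        (0 < n)%N -> exact_at (d 0%N) eps &
        forall i, (i.+1 < n)%N -> exact_at (d i.+1) (d i)].

Definition preenvelope (X : lmodType S -> Prop) (M Y : lmodType S)
    (phi : {linear M -> Y}) : Prop :=
  X Y /\ forall (Y' : lmodType S) (psi : {linear M -> Y'}), X Y' ->
    exists g : {linear Y -> Y'}, forall m, psi m = g (phi m).

Definition envelope (X : lmodType S -> Prop) (M Y : lmodType S)
    (phi : {linear M -> Y}) : Prop :=
  preenvelope X phi /\
  forall f : {linear Y -> Y}, (forall m, f (phi m) = phi m) -> bijective f.

End Modules.

(* [subLmodType A] is the type of submodules of [P] with carrier [A]. *)
Definition right_hereditary (n : nat) (R : pzRingType) : Prop :=
  forall (P : rmodType R) (A : {pred P}) (N : subLmodType A),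
    fin_generated P -> projective P -> fin_presented n.-1 N -> projective N.

(* For every projective resolution ... -> P2 -> P1 -> P0 -> F -> 0, of which
   only the displayed part matters in degree 1, the homology
   ker (d1 (x) M) / im (d2 (x) M) is zero. *)
Definition Tor1_vanishes (R : pzRingType) (F : rmodType R) (M : lmodType R) :
    Prop :=
  forall (P0 P1 P2 : rmodType R) (eps : {linear P0 -> F})
         (d1 : {linear P1 -> P0}) (d2 : {linear P2 -> P1}),
    projective P0 -> projective P1 -> projective P2 ->
    surjective eps -> exact_at d1 eps -> exact_at d2 d1 ->
    exact_at (@tensor_map R P2 P1 M d2) (@tensor_map R P1 P0 M d1).

Definition FP_flat (n : nat) (R : pzRingType) (M : lmodType R) : Prop :=
  forall F : rmodType R, fin_presented n F -> Tor1_vanishes F M.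

(* Main.v *)
Require Import Defs.
From HB Require Import structures.
From mathcomp Require Import all_boot all_algebra.
From mathcomp Require Import boolp.
From mathcomp.multinomials Require Import freeg.

Set Implicit Arguments.
Unset Strict Implicit.
Unset Printing Implicit Defensive.

Import GRing.Theory.
Local Open Scope ring_scope.
Local Open Scope quotient_scope.

(** Write Flat for the class of FP_n-flat left modules.

    If R is right n-hereditary, a right module F in FP_n has a resolution
    0 -> K -> P -> F -> 0 with P and K finitely generated projective, since the
    first syzygy K is finitely (n-1)-presented.  Hence Y is in Flat as soon as
    K (x) Y -> P (x) Y is injective for these F.  A dual basis of K turns
    elements of K (x) Y into tuples of elements of Y, so this injectivity can be
    tested after mapping Y to modules Z in Flat, provided these maps separate
    the points of Y ([FP_flat_cogenerated]).  It follows that the quotient of M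
    by the common kernel of all the maps from M to modules in Flat is again in
    Flat; as every such map factors through it, it is an epimorphic envelope.
    Computing Tor_1 from one resolution is legitimate because any two are
    homotopy equivalent ([Tor1_vanishes_resolution]).

    Conversely, assume epimorphic preenvelopes exist.  A submodule M of R^l maps
    onto some Y in Flat, and since R^l is in Flat, the inclusion of M factors
    through Y; hence M -> Y is an isomorphism.  Let N be a submodule of a
    finitely generated projective P, with a presentation F1 -d-> F0 -eps-> N by
    finitely generated projectives that extends to length n-1.  Write each y in
    F0 as the sum of the s_j(y) e_j, let f_1 to f_l generate F1, and let a_j in
    R^l be the row of the s_j(d f_i).  Apply the above to the span of the a_j, and
    let b_j in Y correspond to a_j.  The element t = sum_j e_j (x) b_j of
    F0 (x) Y dies in P (x) Y: the latter embeds into P^l, where the image of t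
    has the entries sum_j eps(e_j) s_j(d f_i) = eps(d f_i) = 0.  The module
    P / N is in FP_n and F1 -> F0 -> P begins a resolution of it, so t is the
    image of some sum_j z_j (x) b_j in F1 (x) Y.  Put v_j = e_j - d z_j.  From
    sum_j v_j (x) b_j = 0 one reads off that y |-> sum_j s_j(y) v_j kills the
    image of d; it therefore descends to a map N -> F0, which splits eps because
    eps v_j = eps e_j.  So N is projective ([epi_envelope_hereditary]).  The
    hypothesis n > 1 is used to have F1 finitely generated projective. *)

(** * Quotients and submodules *)

Section QuotientModule.
Variables (S : pzRingType) (V : lmodType S) (A : {pred V}).
Hypothesis clA : submod_closed A.

Definition quotient_kernel : zmodClosed V :=
  HB.pack A (GRing.isZmodClosed.Build V A (GRing.submod_closedB clA)).
Let I := quotient_kernel.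

Definition quotient_module := Quotient.quot I.

HB.instance Definition _ := GRing.Zmodule.on quotient_module.

Let scale (a : S) (q : quotient_module) : quotient_module :=
  \pi_(Quotient.quot I) (a *: repr q).

Let pi_scale a x :
  scale a (\pi_(Quotient.quot I) x) = \pi_(Quotient.quot I) (a *: x).
Proof.
apply/eqP; rewrite -Quotient.idealrBE -scalerBr.
apply: (GRing.subsemimod_closedZ (GRing.submod_closed_semi clA)).
by rewrite (Quotient.idealrBE I) reprK.
Qed.

Let pi_surj q : exists x, q = \pi_(Quotient.quot I) x.
Proof. by exists (repr q); rewrite reprK. Qed.

Fact quotient_scaleA a b q : scale a (scale b q) = scale (a * b) q.
Proof. by have [x ->] := pi_surj q; rewrite !pi_scale scalerA. Qed.

Fact quotient_scale1 : left_id 1 scale.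
Proof. by move=> q; have [x ->] := pi_surj q; rewrite pi_scale scale1r. Qed.

Fact quotient_scaleDr : right_distributive scale +%R.
Proof.
move=> a q r; have [x ->] := pi_surj q; have [y ->] := pi_surj r.
by rewrite -raddfD !pi_scale scalerDr raddfD.
Qed.

Fact quotient_scaleDl q : {morph scale^~ q : a b / a + b}.
Proof.
move=> a b; have [x ->] := pi_surj q.
by rewrite !pi_scale scalerDl raddfD.
Qed.

HB.instance Definition _ :=
  GRing.Zmodule_isLmodule.Build S quotient_module
    quotient_scaleA quotient_scale1 quotient_scaleDr quotient_scaleDl.

Definition quotient_pi (x : V) : quotient_module := \pi_(Quotient.quot I) x.

Fact quotient_pi_linear : linear quotient_pi.
Proof.
move=> a x y; rewrite /quotient_pi raddfD; congr (_ + _).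
by rewrite /= -pi_scale.
Qed.

HB.instance Definition _ :=
  GRing.isLinear.Build S V quotient_module _ quotient_pi quotient_pi_linear.

End QuotientModule.

Section Submodule.
Variables (S : pzRingType) (V : lmodType S) (A : {pred V}).
Hypothesis clA : submod_closed A.

(** The argument carries the closure proof that the module instance needs. *)
Definition submodule of submod_closed A : predArgType := {x : V | A x}.

HB.instance Definition _ := SubChoice.on (submodule clA).
HB.instance Definition _ :=
  GRing.SubChoice_isSubLmodule.Build S V A (submodule clA)
    (GRing.submod_closed_semi clA).

End Submodule.

Section Modules.
Variable S : pzRingType.
Implicit Types U V W P Q : lmodType S.

Lemma exists_quotient V (A : {pred V}) : submod_closed A ->
  exists (Q : lmodType S) (pi : {linear V -> Q}),
    surjective pi /\ forall x, pi x = 0 <-> x \in A.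
Proof.
move=> clA; exists (quotient_module clA), (quotient_pi clA : {linear _ -> _}).
split=> [q|x].
  by exists (repr q); rewrite /= /quotient_pi reprK.
rewrite -(linear0 (quotient_pi clA)) -[in x \in A](subr0 x).
rewrite (Quotient.idealrBE (quotient_kernel clA)); split=> [e|/eqP e].
  by apply/eqP; exact: e.
exact: e.
Qed.

Lemma exists_submodule V (A : {pred V}) : submod_closed A ->
  inhabited (subLmodType A).
Proof.
by move=> clA; exact: (inhabits (submodule clA : subLmodType A)).
Qed.

Lemma subLmodType_closed V (A : {pred V}) (N : subLmodType A) : submod_closed A.
Proof.
have valA (y : N) : \val y \in A by apply: valP.
split=> [|c x y xA yA].
  by rewrite -(linear0 (\val : {linear N -> V})); apply: valA.
have [[x' <-] [y' <-]] :
    (exists z : N, \val z = x) /\ (exists z : N, \val z = y).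
  by split; [exists (Sub x xA) | exists (Sub y yA)]; apply: SubK.
by rewrite -linearP; apply: valA.
Qed.

Lemma exists_linear V W (f : V -> W) : linear f ->
  exists g : {linear V -> W}, g =1 f.
Proof.
move=> lf; pose g : {linear V -> W} :=
  HB.pack f (GRing.isLinear.Build S V W _ f lf).
by exists g.
Qed.

Lemma factor_through_injection U V W
    (u : {linear U -> V}) (f : {linear W -> V}) :
  injective u -> (forall x, exists y, u y = f x) ->
  exists g : {linear W -> U}, forall x, u (g x) = f x.
Proof.
move=> u_inj fu; pose g x := sval (cid (fu x)).
have ug x : u (g x) = f x by rewrite /g; case: cid.
have [|g' g'E] := @exists_linear _ _ g.
  by move=> a x y; apply: u_inj; rewrite !linearP !ug linearP.
by exists g' => x; rewrite g'E ug.
Qed.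

Lemma factor_through_surjection U V W
    (p : {linear V -> U}) (f : {linear V -> W}) :
  surjective p -> (forall x, p x = 0 -> f x = 0) ->
  exists g : {linear U -> W}, forall x, g (p x) = f x.
Proof.
move=> p_surj pf; pose g y := f (sval (cid (p_surj y))).
have gp x : g (p x) = f x.
  rewrite /g; case: cid => z /= pz; apply/eqP; rewrite -subr_eq0 -linearB.
  by rewrite pf // linearB pz subrr.
have [|g' g'E] := @exists_linear _ _ g.
  move=> a x y; have [x' <-] := p_surj x; have [y' <-] := p_surj y.
  by rewrite -linearP !gp linearP.
by exists g' => x; rewrite g'E gp.
Qed.

Lemma kernel_submodule V W (f : {linear V -> W}) :
  exists (A : {pred V}) (N : subLmodType A), forall x, f x = 0 <-> x \in A.
Proof.
have clA : submod_closed [pred x | f x == 0].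
  split=> [|a x y]; rewrite !inE ?linear0 // => /eqP fx /eqP fy.
  by rewrite linearP fx fy scaler0 addr0.
have [N] := exists_submodule clA.
by exists _, N => x; rewrite inE; split=> [->|/eqP].
Qed.

Lemma image_submodule V W (f : {linear V -> W}) :
  exists (I : lmodType S) (u : {linear I -> W}) (p : {linear V -> I}),
    [/\ injective u, surjective p & forall x, u (p x) = f x].
Proof.
pose A : {pred W} := fun y => `[< exists x, f x = y >].
have clA : submod_closed A.
  split=> [|a x y]; first by apply/asboolP; exists 0; rewrite linear0.
  move=> /asboolP[x' <-] /asboolP[y' <-]; apply/asboolP.
  by exists (a *: x' + y'); rewrite linearP.
have [I] := exists_submodule clA.
have [|p pE] := @factor_through_injection I W V \val f val_inj.
  move=> x; have Afx : f x \in A by apply/asboolP; exists x.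
  by exists (Sub (f x) Afx); apply: SubK.
exists I, (\val : {linear I -> W}), p; split=> // [|y]; first exact: val_inj.
have /asboolP[x fx] := valP y.
by exists x; apply: val_inj; rewrite -fx -pE.
Qed.

(** * Projective modules *)

(** Projectivity lifts against surjections only; replacing W by the image of g
    makes g surjective.  This is the form used to build maps of complexes. *)
Lemma projective_lift P V W (g : {linear V -> W}) (h : {linear P -> W}) :
  projective P -> (forall x, exists y, g y = h x) ->
  exists k : {linear P -> V}, forall x, g (k x) = h x.
Proof.
move=> projP gh; have [I [u [p [u_inj p_surj up]]]] := image_submodule g.
have [|h' uh'] := @factor_through_injection I W P u h u_inj.
  by move=> x; have [y <-] := gh x; exists (p y).
have [k pk] := projP V I p h' p_surj.
by exists k => x; rewrite -up pk uh'.
Qed.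

Lemma projective_retract P Q (s : {linear P -> Q}) (p : {linear Q -> P}) :
  (forall x, p (s x) = x) -> projective Q -> projective P.
Proof.
move=> ps projQ A B g h g_surj; have [k gk] := projQ A B g (h \o p) g_surj.
by exists (k \o s) => x; rewrite /= gk /= ps.
Qed.

Lemma linear_combination V k (e : 'I_k -> V) :
  exists p : {linear 'rV[S]_k -> V}, forall c, p c = \sum_j c 0 j *: e j.
Proof.
apply: exists_linear => a c d; rewrite scaler_sumr -big_split /=.
by apply: eq_bigr => j _; rewrite !mxE scalerDl scalerA.
Qed.

Lemma dual_basis P : fin_generated P -> projective P ->
  exists k (e : 'I_k -> P) (s : {linear P -> 'rV[S]_k}),
    forall x, x = \sum_j s x 0 j *: e j.
Proof.
move=> [k [e gen_e]] projP; have [p pE] := linear_combination e.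
have [|s ps] := @projective_lift P 'rV[S]_k P p idfun projP.
  move=> x; have [c ->] := gen_e x; exists (\row_j c j); rewrite pE /=.
  by apply: eq_bigr => j _; rewrite mxE.
by exists k, e, s => x; rewrite -pE ps.
Qed.

End Modules.

(** * Tensor products *)

Section TensorProduct.
Variables (R : pzRingType) (F : rmodType R) (M : lmodType R).

Lemma tensor_ind (T : tensor F M -> Prop) :
    (forall t s, T t -> T s -> T (t - s)) -> (forall x m, T (tens x m)) ->
  forall t, T t.
Proof.
move=> TB Tt t.
have T0 : T 0 by rewrite -(subrr (tens 0 0)); apply: TB.
have TN s : T s -> T (- s) by move=> Ts; rewrite -sub0r; apply: TB.
have TD s1 s2 : T s1 -> T s2 -> T (s1 + s2).
  by move=> T1 /TN T2; rewrite -[s2]opprK; apply: TB.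
have [u <-] := tensor_pi_surj t.
elim/freeg_ind_dom0: u => [|k [x m] u _ _ Tu].
  by rewrite -(subrr 0) tensor_piB subrr.
rewrite tensor_piD; apply: (TD) => //.
have Tn n : T (tensor_pi (<< n%:R *g (x, m) >>)).
  elim: n => [|n IHn]; first by rewrite freegU0 -(subrr 0) tensor_piB subrr.
  by rewrite mulrS -freegUD tensor_piD; apply: TD IHn; apply: Tt.
case: k => n; first by rewrite -natz.
rewrite NegzE -freegUN -sub0r tensor_piB -natz; apply: TB => //.
by rewrite -(subrr 0) tensor_piB subrr.
Qed.

Fact tens_right_zmod_morphism (x : F) : zmod_morphism (@tens R F M x).
Proof.
move=> m k; apply/(addIr (tens x k)).
by rewrite -tensDr !subrK.
Qed.

HB.instance Definition _ (x : F) :=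
  GRing.isZmodMorphism.Build M (tensor F M) (@tens R F M x)
    (tens_right_zmod_morphism x).

Lemma tens0l m : tens 0 m = 0 :> tensor F M.
Proof. by apply/(addIr (tens 0 m)); rewrite -tensDl !add0r. Qed.

Lemma tensBl x y m : tens (x - y) m = tens x m - tens y m :> tensor F M.
Proof. by apply/(addIr (tens y m)); rewrite -tensDl !subrK. Qed.

Lemma tens_suml I r (x : I -> F) m :
  tens (\sum_(i <- r) x i) m = \sum_(i <- r) tens (x i) m :> tensor F M.
Proof.
apply: (big_morph (fun y => tens y m : tensor F M)); last exact: tens0l.
by move=> y z; rewrite tensDl.
Qed.

Lemma exists_tensor_lift (A : zmodType) (g : F -> M -> A) : balanced g ->
  exists h : {additive tensor F M -> A}, forall x m, h (tens x m) = g x m.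
Proof.
move=> gB; pose h : {additive tensor F M -> A} :=
  HB.pack (tensor_lift g)
    (GRing.isZmodMorphism.Build _ _ (tensor_lift g) (tensor_liftB gB)).
by exists h => x m; apply: tensor_lift_tens.
Qed.

(** Coefficients move across the tensor sign, so that generators of one factor
    suffice; the z_j are far from unique. *)
Lemma tensor_spanned k (b : 'I_k -> M) :
    (forall m, exists c : 'I_k -> R, m = \sum_j c j *: b j) ->
  forall t : tensor F M, exists z, t = \sum_j tens (z j) (b j).
Proof.
move=> gen_b; elim/tensor_ind => [t s [z ->] [z' ->]|x m].
  exists (fun j => z j - z' j); rewrite -sumrB.
  by apply: eq_bigr => j _; rewrite tensBl.
have [c ->] := gen_b m; exists (fun j => (c j : R^c) *: x).
by rewrite raddf_sum; apply: eq_bigr => j _; rewrite tensZ.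
Qed.

(** The map s_j (x) M from F (x) M to R (x) M = M. *)
Lemma tensor_contract_left k (s : {linear F -> 'rV[R^c]_k}) :
  exists c : 'I_k -> {additive tensor F M -> M},
    forall j x m, c j (tens x m) = (s x 0 j : R) *: m.
Proof.
suff H j : exists h : {additive tensor F M -> M},
    forall x m, h (tens x m) = (s x 0 j : R) *: m.
  by exists (fun j => sval (cid (H j))) => j; case: cid.
apply: (exists_tensor_lift (g := fun x m => (s x 0 j : R) *: m)).
split=> [m x y|x m m'|a x m] /=.
- by rewrite linearD mxE scalerDl.
- by rewrite scalerDr.
- by rewrite linearZ mxE scalerA.
Qed.

(** The map F (x) g from F (x) M to F (x) R^k = F^k, read entry by entry. *)
Lemma tensor_contract_right k (g : {linear M -> 'rV[R]_k}) :
  exists c : 'I_k -> {additive tensor F M -> F},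
    forall i x m, c i (tens x m) = (g m 0 i : R^c) *: x.
Proof.
suff H j : exists h : {additive tensor F M -> F},
    forall x m, h (tens x m) = (g m 0 j : R^c) *: x.
  by exists (fun j => sval (cid (H j))) => j; case: cid.
apply: (exists_tensor_lift (g := fun x m => (g m 0 j : R^c) *: x)).
split=> [m x y|x m m'|a x m] /=.
- by rewrite scalerDr.
- by rewrite linearD mxE scalerDl.
- by rewrite linearZ mxE scalerA.
Qed.

(** A finitely generated projective F is a direct summand of a free module of
    rank k, hence F (x) M is one of M^k: an element is determined by its k
    contractions with the dual basis. *)
Lemma tensor_coordinates :
    fin_generated F -> projective F ->
  exists k (e : 'I_k -> F) (s : {linear F -> 'rV[R^c]_k})
         (c : 'I_k -> {additive tensor F M -> M}),
    (forall j x m, c j (tens x m) = (s x 0 j : R) *: m) /\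
    forall t, t = \sum_j tens (e j) (c j t).
Proof.
move=> fgF projF; have [k [e [s es]]] := dual_basis fgF projF.
have [c cE] := tensor_contract_left s; exists k, e, s, c; split=> //.
elim/tensor_ind => [t u tE uE|x m].
  rewrite {1}tE {1}uE -sumrB.
  by apply: eq_bigr => j _; rewrite !raddfB.
rewrite {1}(es x) tens_suml; apply: eq_bigr => j _.
by rewrite cE -tensZ.
Qed.

End TensorProduct.

Lemma tensor_map_square (R : pzRingType) (F G G' H : rmodType R)
    (M : lmodType R)
    (f : {linear F -> G}) (g : {linear G -> H})
    (f' : {linear F -> G'}) (g' : {linear G' -> H}) :
    (forall x, g (f x) = g' (f' x)) ->
  forall t : tensor F M,
    tensor_map g (tensor_map f t) = tensor_map g' (tensor_map f' t).
Proof.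
move=> gf; elim/tensor_ind => [t s tE sE|x m].
  by rewrite !raddfB /= tE sE.
by rewrite !tensor_map_tens gf.
Qed.

Lemma tensor_map_complex (R : pzRingType) (F G H : rmodType R) (M : lmodType R)
    (f : {linear F -> G}) (g : {linear G -> H}) :
    (forall x, g (f x) = 0) ->
  forall t : tensor F M, tensor_map g (tensor_map f t) = 0.
Proof.
move=> gf; elim/tensor_ind => [t s tE sE|x m].
  by rewrite !raddfB /= tE sE subr0.
by rewrite !tensor_map_tens gf tens0l.
Qed.

(** * Independence of the resolution *)

(** Lifting the identity of F gives maps f from P to Q and g from Q to P, and a
    homotopy h from g f to the identity.  A cycle t of P (x) M is then
    homologous to (g f)(t), and f(t) is a boundary because Q (x) M is exact. *)
Lemma Tor1_vanishes_resolution (R : pzRingType)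
    (F : rmodType R) (M : lmodType R)
    (Q0 Q1 Q2 : rmodType R) (eta : {linear Q0 -> F})
    (c1 : {linear Q1 -> Q0}) (c2 : {linear Q2 -> Q1}) :
    projective Q0 -> projective Q1 -> projective Q2 ->
    surjective eta -> exact_at c1 eta -> exact_at c2 c1 ->
    exact_at (@tensor_map R Q2 Q1 M c2) (@tensor_map R Q1 Q0 M c1) ->
  Tor1_vanishes F M.
Proof.
move=> projQ0 projQ1 projQ2 eta_surj eta_ex c1_ex exQ.
move=> P0 P1 P2 eps d1 d2 projP0 projP1 _ eps_surj eps_ex d1_ex t.
have dd x : d1 (d2 x) = 0 by apply/d1_ex; exists x.
have ed x : eps (d1 x) = 0 by apply/eps_ex; exists x.
have cc x : c1 (c2 x) = 0 by apply/c1_ex; exists x.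
have ec x : eta (c1 x) = 0 by apply/eta_ex; exists x.
split=> [dt|[w <-]]; last exact: tensor_map_complex.
have [f0 f0E] : exists f0 : {linear P0 -> Q0}, forall x, eta (f0 x) = eps x.
  by apply: projective_lift.
have [f1 f1E] : exists f1 : {linear P1 -> Q1},
    forall x, c1 (f1 x) = (f0 \o d1) x.
  by apply: projective_lift => // x; apply/eta_ex; rewrite /= f0E ed.
have [g0 g0E] : exists g0 : {linear Q0 -> P0}, forall x, eps (g0 x) = eta x.
  by apply: projective_lift.
have [g1 g1E] : exists g1 : {linear Q1 -> P1},
    forall x, d1 (g1 x) = (g0 \o c1) x.
  by apply: projective_lift => // x; apply/eps_ex; rewrite /= g0E ec.
have [g2 g2E] : exists g2 : {linear Q2 -> P2},
    forall x, d2 (g2 x) = (g1 \o c2) x.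
  by apply: projective_lift => // x; apply/d1_ex; rewrite /= g1E /= cc linear0.
have [h0 h0E] : exists h0 : {linear P0 -> P1},
    forall x, d1 (h0 x) = ((g0 \o f0) \- idfun) x.
  apply: projective_lift => // x; apply/eps_ex.
  by rewrite /= linearB g0E f0E subrr.
have [h1 h1E] : exists h1 : {linear P1 -> P2},
    forall x, d2 (h1 x) = ((g1 \o f1) \- idfun \- (h0 \o d1)) x.
  apply: projective_lift => // x; apply/d1_ex.
  by rewrite /= !linearB g1E /= f1E /= h0E /= opprB addrA subrK subrr.
have homotopy s : tensor_map g1 (tensor_map f1 s) = s +
    tensor_map d2 (tensor_map h1 s) + tensor_map h0 (tensor_map d1 s)
    :> tensor P1 M.
  elim/tensor_ind: s => [s u sE uE|x m].
    by rewrite !raddfB /= sE uE !opprD addrACA (addrACA s).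
  rewrite !tensor_map_tens -!tensDl h1E /=; congr tens.
  by rewrite -addrA subrK addrC subrK.
have /exQ[w wE] : tensor_map c1 (tensor_map f1 t) = 0.
  by rewrite (tensor_map_square f1E) dt raddf0.
exists (tensor_map g2 w - tensor_map h1 t); rewrite raddfB /=.
by rewrite (tensor_map_square g2E) wE homotopy dt raddf0 addr0 addrK.
Qed.

(** * Finitely presented modules *)

Section FinitePresentation.
Variable S : pzRingType.
Implicit Types F N P : lmodType S.

Lemma fin_presented_generated n F : fin_presented n F -> fin_generated F.
Proof.
move=> [G [d [eps [/(_ 0%N isT)[[k [e gen_e]] _] eps_surj _ _]]]].
exists k, (fun i => eps (e i)) => x; have [y <-] := eps_surj x.
have [c ->] := gen_e y; exists c.
by rewrite linear_sum; apply: eq_bigr => i _; rewrite linearZ.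
Qed.

Lemma fin_presented_syzygy n F : fin_presented n.+1 F ->
  exists (P : lmodType S) (A : {pred P}) (K : subLmodType A)
         (eps : {linear P -> F}),
    [/\ fin_generated P /\ projective P, surjective eps,
        exact_at (\val : {linear K -> P}) eps & fin_presented n K].
Proof.
move=> [G [d [eps [Gfg eps_surj ex0 exS]]]].
have [A [K KE]] := kernel_submodule eps.
have valK : exact_at (\val : {linear K -> G 0%N}) eps.
  move=> x; split=> [/KE Ax|[y <-]]; last exact/KE/valP.
  by exists (Sub x Ax); apply: SubK.
have [|eps' eps'E] :=
    @factor_through_injection S K _ _ (\val : {linear K -> _}) (d 0%N) val_inj.
  by move=> x; apply/valK/(ex0 isT); exists x.
exists (G 0%N), A, K, eps; split=> //; first exact: Gfg.
exists (fun i => G i.+1), (fun i => d i.+1), eps'; split.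
- by move=> i le_in; apply: Gfg.
- move=> y; have /(ex0 isT)[x dx] : eps (\val y) = 0 by apply/valK; exists y.
  by exists x; apply: val_inj; rewrite -dx -eps'E.
- move=> n_gt0 x; split=> [e'x|/(exS 0%N n_gt0) dx].
    by apply/(exS 0%N n_gt0); rewrite -eps'E e'x linear0.
  by apply: val_inj; rewrite linear0 -dx -eps'E.
- by move=> i lt_in; apply: exS.
Qed.

Lemma fin_presented_quotient n N P F
    (u : {linear N -> P}) (pi : {linear P -> F}) :
    fin_generated P -> projective P -> fin_presented n N ->
    injective u -> surjective pi -> exact_at u pi ->
  fin_presented n.+1 F.
Proof.
move=> fgP projP [G [d [eps [Gfg eps_surj ex0 exS]]]] u_inj pi_surj u_pi.
pose G' i := if i is j.+1 then G j else P.
pose d' i : {linear G' i.+1 -> G' i} :=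
  match i return {linear G' i.+1 -> G' i} with
  | 0%N => (u \o eps : {linear G 0%N -> P})
  | j.+1 => d j
  end.
exists G', d', pi; split=> //.
- by case=> [|i] le_in //; apply: Gfg.
- move=> _ x; split=> [/u_pi[y <-]|[y <-]]; last by apply/u_pi; exists (eps y).
  by have [z <-] := eps_surj y; exists z.
- case=> [|i] lt_in; last exact: exS.
  move=> x; rewrite -(ex0 lt_in x) /=; split=> [|->]; last exact: linear0.
  by move=> uex; apply: u_inj; rewrite linear0.
Qed.

End FinitePresentation.

(** * FP-flat modules and envelopes *)

(** Tensoring with R^k amounts to taking k-tuples, which preserves exactness. *)
Lemma FP_flat_rV (n : nat) (R : pzRingType) k : @FP_flat n R 'rV[R]_k.
Proof.
move=> F _ P0 P1 P2 eps d1 d2 _ _ _ _ _ d1_ex t.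
split=> [|[w <-]]; last first.
  by apply: tensor_map_complex => x; apply/d1_ex; exists x.
have [|z ->] := tensor_spanned (b := fun j => delta_mx 0 j : 'rV[R]_k) _ t.
  by move=> c; exists (fun j => c 0 j); apply: row_sum_delta.
have [c cE] := tensor_contract_right P0 (idfun : {linear 'rV[R]_k -> 'rV[R]_k}).
rewrite raddf_sum /= => dz.
have dz0 i : d1 (z i) = 0.
  rewrite -(raddf0 (c i)) -dz raddf_sum (bigD1 i) //= big1 ?addr0.
    by rewrite tensor_map_tens cE mxE !eqxx scale1r.
  move=> j ji; rewrite tensor_map_tens cE mxE eqxx eq_sym (negPf ji).
  exact: scale0r.
pose w i := sval (cid ((d1_ex (z i)).1 (dz0 i))).
have dw i : d2 (w i) = z i by rewrite /w; case: cid.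
exists (\sum_j tens (w j) (delta_mx 0 j)); rewrite raddf_sum.
by apply: eq_bigr => j _; rewrite /= tensor_map_tens dw.
Qed.

(** Over a hereditary ring the test map is K (x) Y -> P (x) Y with K finitely
    generated projective; an element t of its kernel maps to zero in each
    K (x) Z with Z flat, so that psi kills the coordinates of t in Y.  Applied to
    a submodule of a product of flat modules, this says that flatness passes to
    products and submodules. *)
Lemma FP_flat_cogenerated (n : nat) (R : pzRingType) (Y : lmodType R) :
    right_hereditary n.+1 R ->
    (forall y : Y, y <> 0 -> exists (Z : lmodType R) (psi : {linear Y -> Z}),
       FP_flat n.+1 Z /\ psi y <> 0) ->
  FP_flat n.+1 Y.
Proof.
move=> hered cogY F FPF.
have [P [A [K [eps [[fgP projP] eps_surj valK FPK]]]]] :=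
  fin_presented_syzygy FPF.
have fgK := fin_presented_generated FPK.
have projK : projective K by apply: hered FPK.
(* As K is projective, 0 -> K -> P is a resolution; the zero map from K serves
   as the differential from degree 2. *)
have null_val : exact_at (\0 : {linear K -> K}) (\val : {linear K -> P}).
  move=> x; split=> [vx|[y <-]]; last exact: linear0.
  by exists 0; apply: val_inj; rewrite linear0.
apply: (Tor1_vanishes_resolution projP projK projK eps_surj valK null_val) => t.
split=> [vt|[w <-]]; last first.
  by apply: tensor_map_complex => x; apply: linear0.
suff -> : t = 0 by exists 0; apply: raddf0.
have [k [e [s [c [cE t_sum]]]]] := tensor_coordinates Y fgK projK.
rewrite (t_sum t) big1 // => j _; suff -> : c j t = 0 by apply: raddf0.
have [//|/eqP cjt] := eqVneq (c j t) 0; exfalso.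
have [Z [psi [flatZ]]] := cogY _ cjt; apply.
have pushforward (G : rmodType R) :
    exists h : {additive tensor G Y -> tensor G Z},
      forall x y, h (tens x y) = tens x (psi y).
  apply: (exists_tensor_lift (g := fun x y => tens x (psi y))).
  split=> [y x x'|x y y'|a x y] /=; first exact: tensDl.
    by rewrite linearD tensDr.
  by rewrite linearZ tensZ.
have [hK hKE] := pushforward K; have [hP hPE] := pushforward P.
have natural u :
    tensor_map (\val : {linear K -> P}) (hK u) =
    hP (tensor_map (\val : {linear K -> P}) u).
  elim/tensor_ind: u => [u u' uE u'E|x y]; first by rewrite !raddfB /= uE u'E.
  by rewrite hKE !tensor_map_tens hPE.
have ht0 : hK t = 0.
  have exZ :=
    flatZ F FPF _ _ _ _ _ _ projP projK projK eps_surj valK null_val.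
  have /exZ[w <-] : tensor_map (\val : {linear K -> P}) (hK t) = 0.
    by rewrite natural vt raddf0.
  elim/tensor_ind: w => [w w' wE w'E|x y].
    by rewrite raddfB /= wE w'E subr0.
  by rewrite tensor_map_tens tens0l.
have [c' c'E] := tensor_contract_left Z s.
rewrite -(raddf0 (c' j)) -ht0.
move: t {vt cjt ht0}; elim/tensor_ind => [t t' tE t'E|x y].
  by rewrite !raddfB /= tE t'E.
by rewrite hKE cE c'E linearZ.
Qed.

(** The envelope is the largest quotient of M that is cogenerated by flat
    modules.  Its map phi being surjective, an endomorphism f with f phi = phi is
    the identity. *)
Lemma hereditary_epi_envelope (n : nat) (R : pzRingType) (M : lmodType R) :
    right_hereditary n.+1 R ->
  exists (Y : lmodType R) (phi : {linear M -> Y}),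
    envelope (@FP_flat n.+1 R) phi /\ surjective phi.
Proof.
move=> hered.
pose A : {pred M} := fun m =>
  `[< forall (Z : lmodType R) (psi : {linear M -> Z}),
  FP_flat n.+1 Z -> psi m = 0 >].
have clA : submod_closed A.
  split=> [|a x y /asboolP xA /asboolP yA]; apply/asboolP => Z psi flatZ.
    exact: linear0.
  by rewrite linearP xA // yA // scaler0 addr0.
have [Y [phi [phi_surj phi0]]] := exists_quotient clA.
have factor (Z : lmodType R) (psi : {linear M -> Z}) : FP_flat n.+1 Z ->
    exists g : {linear Y -> Z}, forall m, g (phi m) = psi m.
  move=> flatZ; apply: factor_through_surjection => // m /phi0 /asboolP.
  by apply.
exists Y, phi; split=> //; split; last first.
  move=> f fphi; exists idfun => y;
    by have [m <-] := phi_surj y; rewrite /= fphi.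
split=> [|Z psi flatZ]; last first.
  by have [g gphi] := factor Z psi flatZ; exists g => m.
apply: FP_flat_cogenerated => // y; have [m <-] := phi_surj y => phim.
apply: contrapT => none; apply: phim.
apply/phi0/asboolP => Z psi flatZ; apply: contrapT => psim.
have [g gphi] := factor Z psi flatZ.
by apply: none; exists Z, g; split; last rewrite gphi.
Qed.

(** Flatness of the span Y of the relation matrix of N, tested on P / N, forces
    the presentation of N to split. *)
Lemma epi_envelope_hereditary (n : nat) (R : pzRingType) :
    (forall M : lmodType R, exists (Y : lmodType R) (phi : {linear M -> Y}),
       preenvelope (@FP_flat n.+2 R) phi /\ surjective phi) ->
  right_hereditary n.+2 R.
Proof.
move=> preenv P A N fgP projP FPN.
have u_inj : injective (\val : {linear N -> P}) by apply: val_inj.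
set u : {linear N -> P} := \val in u_inj.
have [F [pi [pi_surj pi0]]] := exists_quotient (subLmodType_closed N).
have u_pi : exact_at u pi.
  move=> x; split=> [/pi0 Ax|[y <-]]; last exact/pi0/valP.
  by exists (Sub x Ax); apply: SubK.
have FPF := fin_presented_quotient fgP projP FPN u_inj pi_surj u_pi.
move: FPN => [G [d [eps [Gfg eps_surj /(_ isT) d_eps _]]]].
have [fgG0 projG0] := Gfg 0%N isT; have [[l [f gen_f]] projG1] := Gfg 1%N isT.
have eps_d x : eps (d 0%N x) = 0 by apply/d_eps; exists x.
have [k [e [s es]]] := dual_basis fgG0 projG0.
pose a j : 'rV[R]_l := \row_i (s (d 0%N (f i)) 0 j : R).
have [p pE] := linear_combination a.
have [M [iota [q [iota_inj q_surj iota_q]]]] := image_submodule p.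
have [Y [phi [[flatY phi_pre] phi_surj]]] := preenv M.
have [g gphi] := phi_pre _ iota (@FP_flat_rV _ R l).
have g_inj y : g y = 0 -> y = 0.
  have [x <-] := phi_surj y; rewrite -gphi => ix0.
  by rewrite (iota_inj x 0) ?linear0.
pose b j := phi (q (delta_mx 0 j)).
have gb j : g (b j) = a j.
  rewrite -gphi iota_q pE (bigD1 j) //= big1 ?addr0 => [|i ij].
    by rewrite mxE !eqxx scale1r.
  by rewrite mxE eqxx (negPf ij) scale0r.
have gen_b y : exists c : 'I_k -> R, y = \sum_j c j *: b j.
  have [x <-] := phi_surj y; have [c <-] := q_surj x.
  exists (fun j => c 0 j); rewrite [in LHS](row_sum_delta c) !linear_sum.
  by apply: eq_bigr => j _; rewrite !linearZ.
have relation i : \sum_j s (d 0%N (f i)) 0 j *: eps (e j) = 0.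
  rewrite -[RHS](eps_d (f i)) [in RHS](es (d 0%N (f i))) linear_sum.
  by apply: eq_bigr => j _; rewrite linearZ.
pose d1 : {linear G 0%N -> P} := u \o eps.
pose t : tensor (G 0%N) Y := \sum_j tens (e j) (b j).
(* P (x) Y -> P (x) R^l is injective since P is projective, and over R^l the
   image of t is given by the relations of N. *)
have dt : tensor_map d1 t = 0.
  have [kP [eP [sP [cP [cPE t_sum]]]]] := tensor_coordinates Y fgP projP.
  rewrite (t_sum (tensor_map d1 t)) big1 // => h _.
  suff -> : cP h (tensor_map d1 t) = 0 by apply: raddf0.
  apply: g_inj; rewrite !raddf_sum /=; apply/rowP => i.
  rewrite summxE mxE.
  transitivity (sP (u (\sum_j s (d 0%N (f i)) 0 j *: eps (e j))) 0 h).
    rewrite !linear_sum summxE; apply: eq_bigr => j _.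
    by rewrite tensor_map_tens cPE linearZ gb !linearZ !mxE.
  by rewrite relation !linear0 mxE.
have pi_d1 : exact_at d1 pi.
  move=> x; split=> [/u_pi[y <-]|[y <-]]; last by apply/u_pi; exists (eps y).
  by have [z <-] := eps_surj y; exists z.
have d1_d : exact_at (d 0%N) d1.
  move=> x; rewrite -(d_eps x); split=> [d1x|ex]; last first.
    by rewrite /d1 /= ex linear0.
  by apply: u_inj; rewrite linear0.
have exY := flatY F FPF _ _ _ _ _ _ projP projG0 projG1 pi_surj pi_d1 d1_d.
have /exY[w dw] := dt.
have [z w_sum] := tensor_spanned gen_b w.
(* The v_j are lifts of the eps e_j that satisfy the relations of N. *)
pose v j := e j - d 0%N (z j).
have vb0 : \sum_j tens (v j) (b j) = 0 :> tensor (G 0%N) Y.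
  have -> : \sum_j tens (v j) (b j) = t - tensor_map (d 0%N) w.
    rewrite w_sum raddf_sum -sumrB; apply: eq_bigr => j _.
    by rewrite /= tensor_map_tens tensBl.
  by rewrite dw subrr.
have [V VE] := linear_combination v.
have Vsd i : V (s (d 0%N (f i))) = 0.
  have [c cE] := tensor_contract_right (G 0%N) g.
  rewrite VE -[RHS](raddf0 (c i)) -[in RHS]vb0 raddf_sum; apply: eq_bigr => j _.
  by rewrite cE gb mxE.
have [|sigma sigmaE] :=
    @factor_through_surjection _ _ _ _ eps (V \o s) eps_surj.
  move=> x /d_eps[y <-]; have [c ->] := gen_f y.
  rewrite linear_sum linear_sum big1 // => i _.
  by rewrite !linearZ /= Vsd scaler0.
apply: (projective_retract (s := sigma) (p := eps)) => // y.
have [x <-] := eps_surj y.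
rewrite sigmaE /= VE [in RHS](es x) !linear_sum; apply: eq_bigr => j _.
by rewrite !linearZ linearB eps_d subr0.
Qed.

Theorem proposition3p8 (n : nat) (hn : (1 < n)%N) (R : pzRingType) :
  (forall M : lmodType R,
     exists (Y : lmodType R) (phi : {linear M -> Y}),
       envelope (@FP_flat n R) phi /\ surjective phi)
  <-> right_hereditary n R.
Proof.
case: n hn => [|[|n]] // _; split=> [env|hered M].
  apply: epi_envelope_hereditary => M.
  by have [Y [phi [[pre _] epi]]] := env M; exists Y, phi.
exact: hereditary_epi_envelope.
Qed.
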